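(* Every countably determined equivalence relation $E$ on ${}^*\mathbb N$ all of whose equivalence classes are at most countable admits a countably determined transversal, and hence is CD-smooth.
   Context: Work in a fixed countably saturated nonstandard universe; ${}^*\mathbb N$ = hyperintegers. A set (e.g. a subset of ${}^*\mathbb N\times{}^*\mathbb N$) is countably determined (CD) if it equals $\bigcup_{f\in F}\bigcap_{m\in\mathbb N}X_{f\restriction m}$ for some $F\subseteq2^{\mathbb N}$ and internal sets $X_s$ ($s$ finite binary sequences) with $X_t\subseteq X_s$ for $s\subset t$; an equivalence relation is CD if its graph is, and a map is CD if its graph is. A transversal of $E$ is a set meeting each $E$-class in exactly one point. $E$ is CD-smooth if there is a CD map $\vartheta$ defined on the domain of $E$ with values in ${}^*\mathbb N$ such that $x\mathrel E x'\iff\vartheta(x)=\vartheta(x')$. *)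

(* Defs.v *)
From mathcomp Require Import all_boot.
From mathcomp Require Import all_classical.
From Stdlib Require Export RelationClasses.
From Stdlib Require Eqdep_dec PeanoNat.

Set Implicit Arguments.
Unset Strict Implicit.
Unset Printing Implicit Defensive.

Local Open Scope classical_set_scope.

(* The superstructure V(X) = \bigcup_n V_n(X) over a type X of atoms, where
   V_0(X) = X and V_{n+1}(X) = V_n(X) `|` P(V_n(X)).
   [car (stage X n)] is a copy of V_n(X): passing from V_n to V_{n+1} adds
   exactly those subsets of V_n that are not already elements of V_n, so that
   no set is represented twice and Leibniz equality is extensional equality.
   [ext v] is None if v is an atom and Some of its set of elements
   otherwise. *)
Record layer := Layer { car : Type; ext : car -> option (set car) }.

Definition newset (S : layer) :=
  {A : set (car S) | ~ exists v, ext v = Some A}.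

Definition next_layer (S : layer) : layer :=
  @Layer (car S + newset S)
    (fun v => match v with
              | inl w => omap (fun A => inl @` A) (ext w)
              | inr A => Some (inl @` sval A)
              end).

Fixpoint stage (X : Type) (n : nat) : layer :=
  if n is m.+1 then next_layer (stage X m) else @Layer X (fun=> None).

(* An element is either an atom or a set that is new at a unique stage. *)
Definition superstructure (X : Type) : Type :=
  X + {n : nat & newset (stage X n)}.

Definition atom (X : Type) (x : X) : superstructure X := inl x.

Definition vset_new (X : Type) n (A : newset (stage X n)) : superstructure X :=
  inr (existT _ n A).

Fixpoint inj (X : Type) n : car (stage X n) -> superstructure X :=
  match n return car (stage X n) -> superstructure X with
  | 0 => @atom X
  | m.+1 => fun v => match v with
                     | inl w => inj w
                     | inr A => vset_new A
                     end
  end.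

Definition is_set (X : Type) (v : superstructure X) : Prop :=
  if v is inr _ then True else False.

Definition vmem (X : Type) (u v : superstructure X) : Prop :=
  match v with
  | inl _ => False
  | inr (existT n A) => exists2 w : car (stage X n), sval A w & u = inj w
  end.

(* The element of V(X) given by a subset of V_n(X). *)
Definition vset (X : Type) n (A : set (car (stage X n))) : superstructure X :=
  match pselect (exists v, ext v = Some A) with
  | left h => inj (sval (cid h))
  | right h => vset_new (exist _ A h)
  end.

Section SuperstructureTheory.
Variable X : Type.
Implicit Types u v : superstructure X.

Lemma inj_vset_new_lt n (v : car (stage X n)) m (A : newset (stage X m)) :
  inj v = vset_new A -> (m < n)%N.
Proof.
elim: n v => [|n IH] //= [w /IH /ltnW //|B [e _]].
by rewrite e.
Qed.

Lemma inj_inj n : injective (@inj X n).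
Proof.
elim: n => [|n IH] /=; first by move=> x y [].
move=> [v|A] [w|B] => [/IH -> //|h|h|h].
- by have := inj_vset_new_lt h; rewrite ltnn.
- by have := inj_vset_new_lt (esym h); rewrite ltnn.
- congr inr; case: h => h.
  exact: (Eqdep_dec.inj_pair2_eq_dec _ PeanoNat.Nat.eq_dec _ _ _ _ h).
Qed.

Lemma inj_None n (v : car (stage X n)) :
  ext v = None -> exists x, inj v = atom x.
Proof.
elim: n v => [|n IH] /= v; first by exists v.
by case: v => [w|//]; case e: (ext w) => [//|] _; exact: IH.
Qed.

Lemma inj_Some n (v : car (stage X n)) A : ext v = Some A ->
  is_set (inj v) /\
  forall u, vmem u (inj v) <-> exists2 w, A w & u = inj w.
Proof.
elim: n v A => [//|n IH] /= [v|B] A.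
  case e: (ext v) => [C|//] [<-]; have [sv mv] := IH _ _ e.
  split=> // u; rewrite mv; split=> [[w Cw ->]|[_ [w Cw <-] ->]]; last by exists w.
  by exists (inl w) => //; exists w.
case=> <-; split=> // u; split=> [[w Bw ->]|[_ [w Bw <-] ->]]; last by exists w.
by exists (inl w) => //; exists w.
Qed.

Lemma inj_lift n m (v : car (stage X n)) : (n <= m)%N ->
  exists w : car (stage X m), inj w = inj v.
Proof.
elim: m => [|m IH].
  by rewrite leqn0 => /eqP e; move: v; rewrite e => v; exists v.
rewrite leq_eqVlt => /orP[/eqP e|]; first by move: v {IH}; rewrite e => v; exists v.
by rewrite ltnS => /IH [w ew]; exists (inl w).
Qed.

Lemma vmem_atom u x : ~ vmem u (atom x).
Proof. by []. Qed.

Lemma vset_is_set n (A : set (car (stage X n))) : is_set (vset A).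
Proof.
rewrite /vset; case: pselect => [h|//].
by case: (cid h) => v e /=; case: (inj_Some e).
Qed.

Lemma vmem_vset n (A : set (car (stage X n))) u :
  vmem u (vset A) <-> exists2 w, A w & u = inj w.
Proof.
rewrite /vset; case: pselect => [h|//].
by case: (cid h) => v e /=; case: (inj_Some e).
Qed.

Lemma vset_ext u v : is_set u -> is_set v ->
  (forall z, vmem z u <-> vmem z v) -> u = v.
Proof.
case: u => // -[n A] _; case: v => // -[m B] _.
wlog le_nm : n A m B / (n <= m)%N.
  move=> H; have [le_nm|/ltnW le_mn] := leqP n m; first exact: H.
  by move=> e; apply/esym; apply: H => // z; rewrite e.
move: le_nm; rewrite leq_eqVlt => /orP[/eqP e|lt_nm].
  move: A; rewrite e => A eAB; congr (inr (existT _ _ _)).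
  apply: eq_sig_hprop => [? ? ?|]; first exact: Prop_irrelevance.
  apply/seteqP; split=> w Hw.
    by have [|w' Bw' /inj_inj ->] := (eAB (inj w)).1; [exists w|].
  by have [|w' Bw' /inj_inj ->] := (eAB (inj w)).2; [exists w|].
move=> eAB; exfalso; apply: (svalP B).
have [w /= ew] := @inj_lift n.+1 m (inr A) lt_nm.
case ex: (ext w) => [C|]; last by have [x] := inj_None ex; rewrite ew.
have [_ mw] := inj_Some ex; exists w; rewrite ex.
congr Some; apply/seteqP; split=> z Hz.
  have /eAB[w' Bw' /inj_inj -> //] : vmem (inj z) (vset_new A).
  by rewrite -ew mw; exists z.
have /eAB : vmem (inj z) (vset_new B) by exists z.
by rewrite -[inr _]ew mw => -[w' Cw' /inj_inj ->].
Qed.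

End SuperstructureTheory.

(* Bounded formulas of the language {=, \in}; variables are de Bruijn
   indices, and index 0 is the variable bound by the innermost quantifier.
   Parameters are supplied by the environment. *)
Inductive bformula : Type :=
| BEq of nat & nat
| BMem of nat & nat
| BNot of bformula
| BAnd of bformula & bformula
| BOr of bformula & bformula
| BImp of bformula & bformula
| BAll of nat & bformula (* BAll j p : forall x \in v_j, p *)
| BEx of nat & bformula. (* BEx j p : exists x \in v_j, p *)

Definition scons (T : Type) (x : T) (e : nat -> T) : nat -> T :=
  fun i => if i is j.+1 then e j else x.

Fixpoint bsat (X : Type) (p : bformula) (e : nat -> superstructure X) : Prop :=
  match p with
  | BEq i j => e i = e j
  | BMem i j => vmem (e i) (e j)
  | BNot q => ~ bsat q e
  | BAnd q r => bsat q e /\ bsat r e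
  | BOr q r => bsat q e \/ bsat r e
  | BImp q r => bsat q e -> bsat r e
  | BAll j q => forall x, vmem x (e j) -> bsat q (scons x e)
  | BEx j q => exists2 x, vmem x (e j) & bsat q (scons x e)
  end.

(* A nonstandard universe (V(X), V(Y), star) over a base set X of atoms that
   contains a copy of nat.  Properness of star is not required here: it
   follows from countable saturation. *)
Record nonstandard_universe := NonstandardUniverse {
  base : Type;
  hbase : Type;
  nat_base : nat -> base;
  nat_base_inj : injective nat_base;
  star : superstructure base -> superstructure hbase;
  star_base : star (@vset base 0 setT) = @vset hbase 0 setT;
  transfer : forall (p : bformula) (e : nat -> superstructure base),
    bsat p e <-> bsat p (star \o e)
}.

Section Internal.
Variable U : nonstandard_universe.
Implicit Types v a p x y : superstructure (hbase U).

Definition internal v : Prop :=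
  exists2 s : superstructure (base U), is_set s & vmem v (star s).

Definition countably_saturated : Prop :=
  forall a : nat -> superstructure (hbase U),
    (forall n, internal (a n) /\ is_set (a n)) ->
    (forall n, exists v, forall k, (k <= n)%N -> vmem v (a k)) ->
    exists v, forall k, vmem v (a k).

Definition vnat : superstructure (base U) :=
  @vset (base U) 0 (range (@nat_base U)).

Definition hypernat : Type :=
  {v : superstructure (hbase U) | vmem v (star vnat)}.

(* p is the Kuratowski pair {{x}, {x, y}}. *)
Definition is_pair p x y : Prop :=
  forall z, vmem z p <->
    (forall w, vmem w z <-> w = x) \/ (forall w, vmem w z <-> w = x \/ w = y).

Definition internal_collection (A : set (superstructure (hbase U))) : Prop :=
  exists a, [/\ internal a, is_set a & forall v, vmem v a <-> A v].

Definition internal1 (A : set hypernat) : Prop :=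
  internal_collection [set sval x | x in A].

Definition internal2 (A : set (hypernat * hypernat)) : Prop :=
  internal_collection
    [set p | exists2 xy, A xy & is_pair p (sval xy.1) (sval xy.2)].

End Internal.

(* [Int] is the class of internal subsets of T; the finite sequence
   f restricted to m is [mkseq f m]. *)
Definition countably_determined (T : Type) (Int : set T -> Prop) (A : set T)
    : Prop :=
  exists (F : set (nat -> bool)) (S : seq bool -> set T),
    [/\ forall s, Int (S s),
        forall s t, prefix s t -> S t `<=` S s
      & A = \bigcup_(f in F) \bigcap_(m in [set: nat]) S (mkseq f m)].

Section CountablyDetermined.
Variable U : nonstandard_universe.

Definition CD1 : set (hypernat U) -> Prop :=
  countably_determined (@internal1 U).

Definition CD2 : set (hypernat U * hypernat U) -> Prop :=
  countably_determined (@internal2 U).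

Definition CD_relation (E : hypernat U -> hypernat U -> Prop) : Prop :=
  CD2 [set xy | E xy.1 xy.2].

Definition CD_map (f : hypernat U -> hypernat U) : Prop :=
  CD2 [set xy | xy.2 = f xy.1].

Definition transversal_of (E : hypernat U -> hypernat U -> Prop)
    (A : set (hypernat U)) : Prop :=
  forall x, exists! y, A y /\ E x y.

Definition CD_smooth (E : hypernat U -> hypernat U -> Prop) : Prop :=
  exists2 theta : hypernat U -> hypernat U, CD_map theta &
    forall x x', E x x' <-> theta x = theta x'.

End CountablyDetermined.

(* Main.v *)
Require Import Defs.
From mathcomp Require Import all_boot.
From mathcomp Require Import all_classical.

(** Write [E] as the union over [f] in [F] of the sets [\bigcap_m X_(f|m)].  If the
section of [\bigcap_m X_(f|m)] at [x] is countable, then by saturation some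
[X_(f|m)] already has a finite section at [x].  Uniformizing each [X_s]
internally, and repeating this with what remains, gives countably many internal
partial functions [G_i] whose graphs cover [E].  By transfer, a regressive
internal partial function [g] has an internal set [C] such that [x] is in [C] iff
[g x] is not; applied to the regressive parts of the [G_i], this gives internal
sets [C_i], and the type [{i | x \in C_i}] of [x] distinguishes the points of
each class.  A choice function on sets of types selects one type, hence one
point, in each class.  Whether [x] is selected depends only on which of countably
many internal sets contain [x], and a set with this property is countably
determined. *)

Set Implicit Arguments.
Unset Strict Implicit.
Unset Printing Implicit Defensive.

Local Open Scope classical_set_scope.

(** * Comprehension and Kuratowski pairs in a superstructure *)

Section Superstructure.
Variable X : Type.
Implicit Types (a p x y z u v w : superstructure X).

Definition is_atom v := exists x : X, v = atom x.

(* [is_pair], for an arbitrary base set instead of [hbase U]. *)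
Definition kpair p x y : Prop :=
  forall z, vmem z p <->
    (forall w, vmem w z <-> w = x) \/ (forall w, vmem w z <-> w = x \/ w = y).

Definition rel2 a x y := exists2 p, vmem p a & kpair p x y.

Lemma vmem_is_set u v : vmem u v -> is_set v.
Proof. by case: v. Qed.

Lemma vmem_base v : vmem v (@vset X 0 setT) <-> is_atom v.
Proof.
by rewrite vmem_vset; split=> [[w _ ->]|[x ->]]; [exists w|exists x].
Qed.

(** By extensionality [v] is the [vset] of its trace on stage [n], and that trace is either
    represented already ([inl]) or new at the next stage ([inr]). *)
Lemma set_in_stage n v :
  is_set v -> (forall u, vmem u v -> exists w : car (stage X n), u = Defs.inj w) ->
  exists w : car (stage X n.+1), v = Defs.inj w.
Proof.
move=> sv mv.
have -> : v = @vset X n [set w | vmem (Defs.inj w) v].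
  apply: vset_ext => // [|u]; first exact: vset_is_set.
  rewrite vmem_vset; split=> [uv|[w wv -> //]].
  by have [w ew] := mv _ uv; exists w => //=; rewrite -ew.
rewrite /vset; case: pselect => [h|h]; first by exists (inl (sval (cid h))).
pose new (A : set (car (stage X n))) := ~ exists t, ext t = Some A.
by exists (inr (exist new _ h)).
Qed.

Lemma set_comprehension n (Phi : superstructure X -> Prop) :
  exists v, [/\ is_set v, exists w : car (stage X n.+1), v = Defs.inj w
    & forall u, vmem u v <-> Phi u /\ exists w : car (stage X n), u = Defs.inj w].
Proof.
pose v := @vset X n [set w | Phi (Defs.inj w)].
have mv u : vmem u v <-> Phi u /\ exists w : car (stage X n), u = Defs.inj w.
  rewrite vmem_vset; split=> [[w Pw ->]|[Pu [w ew]]]; first by split=> //; exists w.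
  by exists w; rewrite //= -ew.
exists v; split=> //; first exact: vset_is_set.
by apply: set_in_stage; [exact: vset_is_set|move=> u /mv[]].
Qed.

Lemma unordered_pair_in_stage x y z : is_atom x -> is_atom y ->
  (forall w, vmem w z <-> w = x \/ w = y) ->
  exists w : car (stage X 1), z = Defs.inj w.
Proof.
move=> [x' ->] [y' ->] mz; apply: set_in_stage.
  by apply: (@vmem_is_set (atom x')); apply/mz; left.
by move=> u /mz[->|->]; [exists x'|exists y'].
Qed.

Lemma unordered_pair_exists x y : is_atom x -> is_atom y ->
  exists z, forall w, vmem w z <-> w = x \/ w = y.
Proof.
move=> ax ay; have [z [_ _ mz]] := set_comprehension 0 (fun w => w = x \/ w = y).
exists z => w; rewrite mz; split=> [[]//|e]; split=> //.
by case: e => ->; [case: ax|case: ay] => t ->; exists t.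
Qed.

Lemma singleton_exists x : is_atom x ->
  exists z, forall w, vmem w z <-> w = x.
Proof.
move=> ax; have [z mz] := unordered_pair_exists ax ax.
by exists z => w; rewrite mz; split=> [[]|]; auto.
Qed.

Lemma pair_in_stage p x y : is_atom x -> is_atom y -> kpair p x y ->
  exists w : car (stage X 2), p = Defs.inj w.
Proof.
move=> ax ay pp; apply: set_in_stage.
  have [z mz] := singleton_exists ax.
  by apply: (@vmem_is_set z); apply/pp; left.
move=> z /pp[mz|]; last exact: unordered_pair_in_stage.
apply: (unordered_pair_in_stage ax ax) => w.
by rewrite mz; split=> [|[]]; auto.
Qed.

Lemma pair_exists x y : is_atom x -> is_atom y -> exists p, kpair p x y.
Proof.
move=> ax ay; have [p [_ _ mp]] := set_comprehension 1 (fun z =>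
  (forall w, vmem w z <-> w = x) \/ (forall w, vmem w z <-> w = x \/ w = y)).
exists p => z; rewrite mp; split=> [[]//|e]; split=> //.
case: e => mz; last exact: (unordered_pair_in_stage ax ay).
apply: (unordered_pair_in_stage ax ax) => w.
by rewrite mz; split=> [|[]]; auto.
Qed.

Lemma pair_unique p q x y : is_atom x -> kpair p x y -> kpair q x y -> p = q.
Proof.
move=> ax pp pq; have [z mz] := singleton_exists ax.
apply: vset_ext.
- by apply: (@vmem_is_set z); apply/pp; left.
- by apply: (@vmem_is_set z); apply/pq; left.
- by move=> u; rewrite (pp u) (pq u).
Qed.

Lemma pair_inj p x y x' y' :
    is_atom x -> is_atom y -> is_atom x' -> is_atom y' ->
  kpair p x y -> kpair p x' y' -> x = x' /\ y = y'.
Proof.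
move=> ax ay ax' ay' pp pq.
have [z mz] := singleton_exists ax.
have [t mt] := unordered_pair_exists ax ay.
have [t' mt'] := unordered_pair_exists ax' ay'.
have zp : vmem z p by apply/pp; left.
have tp : vmem t p by apply/pp; right.
have tp' : vmem t' p by apply/pq; right.
have ex : x = x'.
  by case/pq: zp => h; apply/esym/mz/h; [|left].
subst x'; split=> //.
have yt : vmem y t by apply/mt; right.
have yt' : vmem y' t' by apply/mt'; right.
have : y = x \/ y = y' by case/pq: tp => /(_ y)[h _]; have := h yt; auto.
have : y' = x \/ y' = y by case/pp: tp' => /(_ y')[h _]; have := h yt'; auto.
by move=> [?|?] [?|?]; congruence.
Qed.

End Superstructure.

(** * Bounded formulas for pairs and binary relations *)

Section Formulas.

Definition BIff p q := BAnd (BImp p q) (BImp q p).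

Definition BSing z x := BAnd (BMem x z) (BAll z (BEq 0 x.+1)).

Definition BUPair z x y :=
  BAnd (BAnd (BMem x z) (BMem y z)) (BAll z (BOr (BEq 0 x.+1) (BEq 0 y.+1))).

(* Locked, so that simplification of [bsat] stops there. *)
Definition BPair p x y := locked (
  BAnd (BAnd (BEx p (BSing 0 x.+1)) (BEx p (BUPair 0 x.+1 y.+1)))
       (BAll p (BOr (BSing 0 x.+1) (BUPair 0 x.+1 y.+1)))).

Definition BRel a x y := locked (BEx a (BPair 0 x.+1 y.+1)).

Variables (X : Type).
Implicit Types e : nat -> superstructure X.

Lemma bsat_sing z x e : bsat (BSing z x) e <-> forall w, vmem w (e z) <-> w = e x.
Proof.
split=> /= [[xz h] w|h]; first by split=> [/h|->].
by split=> [|w /h //]; apply/h.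
Qed.

Lemma bsat_upair z x y e :
  bsat (BUPair z x y) e <-> forall w, vmem w (e z) <-> w = e x \/ w = e y.
Proof.
split=> /= [[[xz yz] h] w|h]; first by split=> [/h|[->|->]].
by split=> [|w /h //]; split; apply/h; auto.
Qed.

(** [kpair] quantifies over all [z], the formula only over members of the pair. For atoms the
    singleton and the unordered pair exist, and extensionality makes them unique, so the two
    readings agree. *)
Lemma bsat_pair p x y e : is_atom (e x) -> is_atom (e y) ->
  bsat (BPair p x y) e <-> kpair (e p) (e x) (e y).
Proof.
move=> ax ay; rewrite /BPair -lock; split.
  move=> [[[s sp hs] [t tp ht]] h] z.
  have /= ms := (bsat_sing 0 x.+1 (scons s e)).1 hs.
  have /= mt := (bsat_upair 0 x.+1 y.+1 (scons t e)).1 ht.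
  split=> [zp|[mz|mz]].
  - case: (h _ zp) => [/(bsat_sing 0 x.+1 (scons z e)).1|] /=; first by left.
    by move=> /(bsat_upair 0 x.+1 y.+1 (scons z e)).1 /=; right.
  - suff -> : z = s by [].
    apply: vset_ext => [| |w].
    + by apply: (@vmem_is_set _ (e x)); apply/mz.
    + by apply: (@vmem_is_set _ (e x)); apply/ms.
    + by rewrite mz ms.
  - suff -> : z = t by [].
    apply: vset_ext => [| |w].
    + by apply: (@vmem_is_set _ (e x)); apply/mz; left.
    + by apply: (@vmem_is_set _ (e x)); apply/mt; left.
    + by rewrite mz mt.
move=> pp; split; [split|].
- have [z mz] := singleton_exists ax.
  by exists z; [apply/pp; left|apply/bsat_sing].
- have [z mz] := unordered_pair_exists ax ay.
  by exists z; [apply/pp; right|apply/bsat_upair].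
- by move=> z /pp[mz|mz]; [left; apply/bsat_sing|right; apply/bsat_upair].
Qed.

Lemma bsat_rel a x y e : is_atom (e x) -> is_atom (e y) ->
  bsat (BRel a x y) e <-> rel2 (e a) (e x) (e y).
Proof.
move=> ax ay; rewrite /BRel -lock; have h p := @bsat_pair 0 x.+1 y.+1 (scons p e) ax ay.
by split=> -[p pa /h]; exists p.
Qed.

End Formulas.
Arguments BPair : simpl never.
Arguments BRel : simpl never.

(** * Transfer and internal sets of hypernaturals *)

Lemma star_scons (S T : Type) (g : S -> T) (x : S) (e : nat -> S) :
  g \o scons x e = scons (g x) (g \o e).
Proof. by apply/funext => -[]. Qed.

Section Transfer.
Variable U : nonstandard_universe.
Notation V := (superstructure (base U)).
Notation W := (superstructure (hbase U)).
Notation N := (vnat U).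

Lemma vmem_vnat (x : V) : vmem x N <-> exists n, x = atom (nat_base U n).
Proof.
rewrite vmem_vset; split=> [[_ [n _ <-] ->]|[n ->]]; first by exists n.
by exists (nat_base U n) => //; exists n.
Qed.

Lemma vnat_atom (x : V) : vmem x N -> is_atom x.
Proof. by move=> /vmem_vnat[n ->]; exists (nat_base U n). Qed.

(** Transfer of the inclusion of [N] in the set of all atoms, whose star is again the set of all
    atoms by [star_base]. *)
Lemma star_vnat_atom (x : W) : vmem x (star N) -> is_atom x.
Proof.
have /= := (transfer (BAll 0 (BMem 0 2)) (scons N (fun=> @vset _ 0 setT))).1.
rewrite star_base => h xN; apply/vmem_base; apply: h => // v vN.
exact/vmem_base/vnat_atom.
Qed.

Lemma vmem_hypernat (x : W) : vmem x (star N) -> exists h : hypernat U, x = sval h.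
Proof. by move=> xN; exists (exist (fun v => vmem v (star N)) x xN). Qed.

Lemma hypernat_inj (x y : hypernat U) : sval x = sval y -> x = y.
Proof. by apply: eq_sig_hprop => ? ? ?; exact: Prop_irrelevance. Qed.

Lemma hypernat_atom (x : hypernat U) : is_atom (sval x).
Proof. exact: star_vnat_atom (svalP x). Qed.

(** The levels 1 here and 3 in [powNN] arise because atoms lie in stage 0, so sets of atoms lie in
    stage 1, while pairs of atoms lie in stage 2, so sets of pairs lie in stage 3. *)
Definition powN : V := @vset _ 1 [set v |
  is_set (Defs.inj v) /\ forall x, vmem x (Defs.inj v) -> vmem x N].

Definition powNN : V := @vset _ 3 [set v |
  is_set (Defs.inj v) /\ forall p, vmem p (Defs.inj v) ->
    exists x y, [/\ vmem x N, vmem y N & kpair p x y]].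

Lemma powNP v : vmem v powN -> is_set v /\ forall x, vmem x v -> vmem x N.
Proof. by move=> /vmem_vset[w + ->]. Qed.

Lemma powNNP v : vmem v powNN -> is_set v /\ forall p, vmem p v ->
  exists x y, [/\ vmem x N, vmem y N & kpair p x y].
Proof. by move=> /vmem_vset[w + ->]. Qed.

Lemma powN_comprehension (Phi : V -> Prop) :
  exists2 c, vmem c powN & forall x, vmem x N -> (vmem x c <-> Phi x).
Proof.
have [c [sc [w ew] mc]] :=
  set_comprehension (X := base U) 0 (fun x => vmem x N /\ Phi x).
exists c.
  by apply/vmem_vset; exists w => //; rewrite /mkset -ew; split=> // x /mc[[]].
move=> x xN; rewrite mc; split=> [[[]]//|Px]; split=> //.
by have [t ->] := vnat_atom xN; exists t.
Qed.

Lemma powNN_comprehension (Phi : V -> V -> Prop) :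
  exists2 c, vmem c powNN &
    forall x y, vmem x N -> vmem y N -> (rel2 c x y <-> Phi x y).
Proof.
have [c [sc [w ew] mc]] := set_comprehension (X := base U) 2
  (fun p => exists x y, [/\ vmem x N, vmem y N, kpair p x y & Phi x y]).
exists c.
  apply/vmem_vset; exists w => //; rewrite /mkset -ew; split=> // p.
  by move=> /mc[[x [y [? ? ? _]]] _]; exists x, y.
move=> x y xN yN; split=> [[p /mc[[x' [y' [x'N y'N p' Pxy]]] _] pp]|Pxy].
  have [-> -> //] :=
    pair_inj (vnat_atom xN) (vnat_atom yN) (vnat_atom x'N) (vnat_atom y'N) pp p'.
have [p pp] := pair_exists (vnat_atom xN) (vnat_atom yN).
exists p => //; apply/mc; split; first by exists x, y.
exact: pair_in_stage (vnat_atom xN) (vnat_atom yN) pp.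
Qed.

(** Being a set is expressed by a bounded formula as not belonging to the set of all atoms, which
    [star] preserves. *)
Lemma star_is_set (P : V) (v : W) :
  (forall u, vmem u P -> is_set u) -> vmem v (star P) -> is_set v.
Proof.
have /= := (transfer (BAll 0 (BNot (BMem 0 2))) (scons P (fun=> @vset _ 0 setT))).1.
rewrite star_base => h sP vP.
have nb : ~ vmem v (@vset (hbase U) 0 setT).
  by apply: h => // u /sP su /vmem_base[t et]; move: su; rewrite et.
by case: v nb {vP} => [t []|//]; apply/vmem_base; exists t.
Qed.

Lemma star_powN (c : W) : vmem c (star powN) -> [/\ internal c, is_set c
  & forall x, vmem x c -> vmem x (star N)].
Proof.
move=> cP; split.
- by exists powN => //; exact: vset_is_set.
- by apply: star_is_set cP => u /powNP[].
- have /= h := (transfer (BAll 0 (BAll 0 (BMem 0 3))) (scons powN (fun=> N))).1.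
  by apply: h => // u /powNP[_].
Qed.

Lemma star_powNN (c : W) : vmem c (star powNN) -> [/\ internal c, is_set c
  & forall p, vmem p c ->
      exists x y : hypernat U, kpair p (sval x) (sval y)].
Proof.
move=> cP; split.
- by exists powNN => //; exact: vset_is_set.
- by apply: star_is_set cP => u /powNNP[].
- have /= h := (transfer (BAll 0 (BAll 0 (BEx 3 (BEx 4 (BPair 2 1 0)))))
    (scons powNN (fun=> N))).1.
  move=> p pc; have [|x xN [y yN pp]] := h _ c cP p pc.
    move=> u /powNNP[_ hu] q /hu[x [y [xN yN pq]]].
    exists x => //; exists y => //.
    by rewrite bsat_pair //=; exact: vnat_atom.
  move: pp; rewrite bsat_pair /=; [|exact: star_vnat_atom..].
  have [hx ->] := vmem_hypernat xN; have [hy ->] := vmem_hypernat yN.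
  by exists hx, hy.
Qed.

(* Environment of [p]: 0 = c, 1 = b, 2 = a, 5 = P, 6 = N, 7 = L; the entries 3
   and 4 are sets whose extensions contain a and b. *)
Lemma transfer_ex (P L : V) (p : bformula) (a b : W) :
  (forall a' b' sa sb : V, exists2 c, vmem c P &
     bsat p (scons c (scons b' (scons a' (scons sa (scons sb
               (scons P (scons N (fun=> L))))))))) ->
  internal a -> internal b ->
  exists sa sb, exists2 c, vmem c (star P) &
     bsat p (scons c (scons b (scons a (scons sa (scons sb
               (scons (star P) (scons (star N) (fun=> star L)))))))).
Proof.
move=> h [sa _ aa] [sb _ bb].
(* An internal parameter belongs to the star of some set, and this bounds the quantifier over it.
   The indices 0, 2, 4 are [sa], [sb], [P], each shifted by the binders already passed. *)
have := (transfer (BAll 0 (BAll 2 (BEx 4 p)))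
  (scons sa (scons sb (scons P (scons N (fun=> L)))))).1.
rewrite !star_scons => /(_ _ a aa b bb) [|c cP pc].
  by move=> a' _ b' _; have [c cP pc] := h a' b' sa sb; exists c.
by exists (star sa), (star sb), c.
Qed.

(** Any internal element may serve as a witness, even one with members outside [star N]: its trace
    on [star N] is internal, by transfer of comprehension inside [N]. *)
Lemma internal1P (A : set (hypernat U)) : internal1 A <->
  exists2 a, internal a & forall x, A x <-> vmem (sval x) a.
Proof.
split=> [[a [ia sa ma]]|[a ia ma]].
  exists a => // x; rewrite ma; split=> [Ax|[y Ay /hypernat_inj <- //]].
  by exists x.
have [|sa [sb [c /star_powN[ic sc cN] /= mc]]] := @transfer_ex powN N
    (BAll 6 (BIff (BMem 0 1) (BMem 0 3))) a a _ ia ia.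
  move=> a' b' sa sb; have [c cP mc] := powN_comprehension (fun x => vmem x a').
  by exists c => //= x /mc [].
exists c; split=> // v; split=> [vc|[x /ma xa <-]]; last exact: (mc _ (svalP x)).2.
have [x ev] := vmem_hypernat (cN v vc).
by exists x => //; apply/ma; rewrite -ev; exact: (mc _ (cN v vc)).1.
Qed.

Lemma internal2P (A : set (hypernat U * hypernat U)) : internal2 A <->
  exists2 a, internal a & forall x y, A (x, y) <-> rel2 a (sval x) (sval y).
Proof.
have at_ := @hypernat_atom.
split=> [[a [ia sa ma]]|[a ia ma]].
  exists a => // x y; split=> [Axy|[p /ma[[x' y'] /= Axy' pp'] pp]].
    have [p pp] := pair_exists (at_ x) (at_ y).
    by exists p => //; apply/ma; exists (x, y).
  have [/hypernat_inj-> /hypernat_inj-> //] :=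
    pair_inj (at_ _) (at_ _) (at_ _) (at_ _) pp pp'.
have [|sa [sb [c /star_powNN[ic sc cN] /= mc]]] := @transfer_ex powNN N
    (BAll 6 (BAll 7 (BIff (BRel 2 1 0) (BRel 4 1 0)))) a a _ ia ia.
  move=> a' b' sa sb; have [c cP mc] := powNN_comprehension (rel2 a').
  exists c => //= x xN y yN.
  have ax := vnat_atom xN; have ay := vnat_atom yN.
  by split; rewrite !bsat_rel //= mc.
have {}mc (x y : hypernat U) : rel2 c (sval x) (sval y) <-> A (x, y).
  have := mc _ (svalP x) _ (svalP y).
  by rewrite ma !bsat_rel /=; [move=> []; split|exact: hypernat_atom..].
exists c; split=> // p; split=> [pc|[[x y] Axy /= pp]].
  have [x [y pp]] := cN p pc.
  by exists (x, y) => //; apply/mc; exists p.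
have /mc[q qc qp] := Axy.
by rewrite (pair_unique (at_ _) pp qp).
Qed.

(** Internal definition principle. [Phi] is given over every base set so that it can be read in both
    universes. Below the quantifier over the element, which is index 0, the parameters [b] and [a]
    have indices 2 and 3, and 7 is [N] or its star. *)
Lemma internal1_comprehension
    (Phi : forall X, superstructure X -> superstructure X ->
           superstructure X -> superstructure X -> Prop) (p : bformula)
    (spec : forall X (e : nat -> superstructure X),
      is_atom (e 0) -> (forall v, vmem v (e 7) -> is_atom v) ->
      bsat p e <-> Phi X (e 7) (e 0) (e 3) (e 2)) (a b : W) :
  internal a -> internal b ->
  internal1 [set x : hypernat U | Phi _ (star N) (sval x) a b].
Proof.
move=> ia ib; have [|sa [sb [c /star_powN[ic _ _] /= mc]]] :=
    @transfer_ex powN N (BAll 6 (BIff (BMem 0 1) p)) a b _ ia ib.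
  move=> a' b' sa sb; have [c cP mc] := powN_comprehension (fun x => Phi _ N x a' b').
  exists c => //= x xN; rewrite spec /=; first exact: mc.
  - exact: vnat_atom.
  - by move=> v; exact: vnat_atom.
apply/internal1P; exists c => // x; have := mc _ (svalP x).
rewrite spec /=; first by case.
- exact: hypernat_atom.
- by move=> v; exact: star_vnat_atom.
Qed.

Lemma internal2_comprehension
    (Phi : forall X, superstructure X -> superstructure X ->
           superstructure X -> superstructure X -> Prop) (p : bformula)
    (spec : forall X (e : nat -> superstructure X),
      is_atom (e 0) -> is_atom (e 1) ->
      bsat p e <-> Phi X (e 1) (e 0) (e 4) (e 3)) (a b : W) :
  internal a -> internal b ->
  internal2 [set xy : hypernat U * hypernat U | Phi _ (sval xy.1) (sval xy.2) a b].
Proof.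
move=> ia ib; have [|sa [sb [c /star_powNN[ic _ _] /= mc]]] :=
    @transfer_ex powNN N (BAll 6 (BAll 7 (BIff (BRel 2 1 0) p))) a b _ ia ib.
  move=> a' b' sa sb.
  have [c cP mc] := powNN_comprehension (fun x y => Phi _ x y a' b').
  exists c => //= x xN y yN; have ax := vnat_atom xN; have ay := vnat_atom yN.
  by rewrite bsat_rel // spec //; exact: mc.
apply/internal2P; exists c => // x y.
have := mc _ (svalP x) _ (svalP y).
by rewrite bsat_rel ?spec //=; [case|exact: hypernat_atom..].
Qed.

Lemma internal_hypernat (x : hypernat U) : internal (sval x).
Proof. by exists N; [exact: vset_is_set|exact: (svalP x)]. Qed.

Lemma eq_internal1 (A B : set (hypernat U)) :
  (forall x, A x <-> B x) -> internal1 A -> internal1 B.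
Proof. by move=> e; suff -> : A = B by []; apply/seteqP; split=> x /e. Qed.

Lemma eq_internal2 (A B : set (hypernat U * hypernat U)) :
  (forall x y, A (x, y) <-> B (x, y)) -> internal2 A -> internal2 B.
Proof.
by move=> e; suff -> : A = B by []; apply/seteqP; split=> -[x y] /e.
Qed.

(** The single Boolean operation proved by transfer: complements and intersections are derived from
    it in [Int_setC] and [Int_setI]. *)
Lemma internal1_nand (A B : set (hypernat U)) :
  internal1 A -> internal1 B -> internal1 [set x | ~ (A x /\ B x)].
Proof.
move=> /internal1P[a ia ea] /internal1P[b ib eb].
apply: eq_internal1 (@internal1_comprehension
  (fun X n x a b => ~ (vmem x a /\ vmem x b))
  (BNot (BAnd (BMem 0 3) (BMem 0 2))) _ a b ia ib) => // x /=.
by rewrite -ea -eb.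
Qed.

Lemma internal1_singleton (z : hypernat U) : internal1 [set z].
Proof.
apply: eq_internal1 (@internal1_comprehension (fun X n x a b => x = a)
  (BEq 0 3) _ _ _ (internal_hypernat z) (internal_hypernat z)) => // x /=.
by split=> [/hypernat_inj|->].
Qed.

Lemma internal1_section (R : set (hypernat U * hypernat U)) (x : hypernat U) :
  internal2 R -> internal1 [set y | R (x, y)].
Proof.
move=> /internal2P[a ia ea].
(* The parameter [b] is not known to be an atom in a general environment, so it is replaced by an
   equal variable ranging over [n], whose members are atoms; [bsat_rel] then applies. *)
apply: eq_internal1 (@internal1_comprehension
  (fun X n y a b => exists2 x, vmem x n & x = b /\ rel2 a x y)
  (BEx 7 (BAnd (BEq 0 3) (BRel 4 0 1))) _ a _ ia (internal_hypernat x)).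
  move=> y /=; rewrite ea; split=> [[_ _ [->]] //|rxy].
  by exists (sval x); [exact: (svalP x)|].
move=> X e ae an /=; split=> -[v vn [<- h]]; exists v => //; split=> //.
  by move: h; rewrite bsat_rel //=; exact: an.
by rewrite bsat_rel //=; exact: an.
Qed.

Lemma internal1_dom (R : set (hypernat U * hypernat U)) :
  internal2 R -> internal1 [set x | exists y, R (x, y)].
Proof.
move=> /internal2P[a ia ea].
apply: eq_internal1 (@internal1_comprehension
  (fun X n x a b => exists2 y, vmem y n & rel2 a x y)
  (BEx 7 (BRel 4 1 0)) _ a a ia ia).
  move=> x /=; split=> [[_ /vmem_hypernat[y ->] rxy]|[y /ea rxy]].
    by exists y; apply/ea.
  by exists (sval y); [exact: (svalP y)|].
move=> X e ae an /=; split=> -[v vn h]; exists v => //.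
  by move: h; rewrite bsat_rel //=; exact: an.
by rewrite bsat_rel //=; exact: an.
Qed.

Lemma internal2_nand (A B : set (hypernat U * hypernat U)) :
  internal2 A -> internal2 B -> internal2 [set x | ~ (A x /\ B x)].
Proof.
move=> /internal2P[a ia ea] /internal2P[b ib eb].
apply: eq_internal2 (@internal2_comprehension
  (fun X x y a b => ~ (rel2 a x y /\ rel2 b x y))
  (BNot (BAnd (BRel 4 1 0) (BRel 3 1 0))) _ a b ia ib) => [x y|X e a0 a1] /=.
  by rewrite ea eb.
by rewrite !bsat_rel.
Qed.

Lemma internal2_snd (A : set (hypernat U)) :
  internal1 A -> internal2 [set xy | A xy.2].
Proof.
move=> /internal1P[a ia ea].
by apply: eq_internal2 (@internal2_comprehension
  (fun X x y a b => vmem y a) (BMem 0 4) _ a a ia ia) => // x y /=; rewrite ea.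
Qed.

(** In the standard universe the axiom of choice gives a selector for any relation on [N]. The
    existence of its graph is a bounded statement, and so transfers. *)
Lemma internal2_uniformization (R : set (hypernat U * hypernat U)) :
  internal2 R -> exists G, [/\ internal2 G, G `<=` R,
    forall x y y', G (x, y) -> G (x, y') -> y' = y
  & forall x y, R (x, y) -> exists y', G (x, y')].
Proof.
move=> /internal2P[a ia ea].
have [|sa [sb [c /star_powNN[ic _ _] /= mc]]] := @transfer_ex powNN N
  (BAll 6 (BAll 7 (BAnd
    (BImp (BRel 2 1 0)
      (BAnd (BRel 4 1 0) (BAll 8 (BImp (BRel 3 2 0) (BEq 0 1)))))
    (BImp (BRel 4 1 0) (BEx 8 (BRel 3 2 0)))))) a a _ ia ia.
  move=> a' b' sa sb.
  have [f Hf] : exists f : V -> V, forall x y, vmem y N -> rel2 a' x y ->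
      vmem (f x) N /\ rel2 a' x (f x).
    have /choice[f Hf] : forall x, exists fx, forall y, vmem y N ->
        rel2 a' x y -> vmem fx N /\ rel2 a' x fx.
      move=> x; have [[y [yN rxy]]|h] := pselect (exists y, vmem y N /\ rel2 a' x y).
        by exists y.
      by exists x => y yN rxy; case: h; exists y.
    by exists f.
  have [c cP mc] := powNN_comprehension (fun x y => rel2 a' x y /\ y = f x).
  exists c => //= x xN y yN; have ax := vnat_atom xN; have ay := vnat_atom yN.
  rewrite !bsat_rel //=; split.
    move=> /(mc _ _ xN yN)[rxy ey]; split=> // z zN.
    rewrite bsat_rel //=; last exact: vnat_atom.
    by move=> /(mc _ _ xN zN)[_ ->]; rewrite ey.
  move=> rxy; have [fN rf] := Hf x y yN rxy; exists (f x) => //.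
  by rewrite bsat_rel //=; [apply/mc|exact: vnat_atom].
have at_ := @hypernat_atom.
have {}mc (x y : hypernat U) : (rel2 c (sval x) (sval y) ->
    R (x, y) /\ forall z, rel2 c (sval x) (sval z) -> z = y) /\
    (R (x, y) -> exists z : hypernat U, rel2 c (sval x) (sval z)).
  have := mc _ (svalP x) _ (svalP y).
  rewrite !bsat_rel //= ea => -[h1 h2]; split.
    move=> /h1[axy h]; split=> // z cxz; apply: hypernat_inj.
    by apply: h; [exact: (svalP z)|rewrite bsat_rel //=].
  move=> /h2[_ /vmem_hypernat[z ->]]; rewrite bsat_rel //= => cxz.
  by exists z.
exists [set xy | rel2 c (sval xy.1) (sval xy.2)]; split.
- by apply/internal2P; exists c.
- by move=> [x y] /(mc _ _).1[].
- by move=> x y y' /(mc _ _).1[_]; apply.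
- by move=> x y /(mc _ _).2.
Qed.

(** * The hypernatural order, regressive colorings and saturation *)

Definition vnat_lt : V :=
  sval (cid2 (powNN_comprehension (fun x y => exists m n,
    [/\ x = atom (nat_base U m), y = atom (nat_base U n) & (m < n)%N]))).

Lemma vnat_ltP m n :
  rel2 vnat_lt (atom (nat_base U m)) (atom (nat_base U n)) <-> (m < n)%N.
Proof.
rewrite /vnat_lt; case: cid2 => c /= _ ->; first last.
- by apply/vmem_vnat; exists n.
- by apply/vmem_vnat; exists m.
split=> [[i [j [[/nat_base_inj ->] [/nat_base_inj ->]]]] //|mn].
by exists m, n.
Qed.

Definition hyperlt (x y : hypernat U) := rel2 (star vnat_lt) (sval x) (sval y).

Lemma hyperlt_total x y : x <> y -> hyperlt x y \/ hyperlt y x.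
Proof.
move=> nxy; have /= h := (transfer (BAll 0 (BAll 1 (BOr (BEq 1 0)
  (BOr (BRel 3 1 0) (BRel 3 0 1))))) (scons N (fun=> vnat_lt))).1.
have [|/=|/=] := h _ _ (svalP x) _ (svalP y).
- move=> _ /vmem_vnat[m ->] _ /vmem_vnat[n ->].
  have am k : is_atom (atom (nat_base U k)) by eexists.
  by rewrite !bsat_rel //= !vnat_ltP; case: (ltngtP m n) => [||->]; auto.
- by move=> /hypernat_inj.
- by rewrite !bsat_rel //=; exact: hypernat_atom.
Qed.

(** [C m] says that [f] can be iterated an odd number of times from [m] before leaving its domain;
    the iteration stops because [f] decreases. In [D k m] the number [k] is fuel, and by [DE] any
    fuel above [m] gives the same answer. *)
Lemma regressive_coloring (f : nat -> nat -> Prop) :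
  (forall m n, f m n -> (n < m)%N) ->
  (forall m n n', f m n -> f m n' -> n' = n) ->
  exists C : nat -> Prop, forall m n, f m n -> (C m <-> ~ C n).
Proof.
move=> f_lt f_fun.
pose D := fix D k m := if k is k'.+1 then exists2 n, f m n & ~ D k' n else False.
have DE k l m : (m < k)%N -> (m < l)%N -> D k m <-> D l m.
  elim: k l m => [//|k IH] [//|l] m /=; rewrite !ltnS => mk ml.
  split=> -[n mn nD]; exists n => //; have nm := f_lt _ _ mn;
    by rewrite (IH l) in nD *; rewrite ?(leq_trans nm).
exists (fun m => D m.+1 m) => m n mn; have nm := f_lt _ _ mn.
rewrite (DE n.+1 m) //=; split=> [[n' /(f_fun _ _ _ mn) -> //]|nD].
by exists n.
Qed.

Lemma internal_coloring (G : set (hypernat U * hypernat U)) :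
  internal2 G -> exists2 C, internal1 C &
    forall x y, G (x, y) -> hyperlt y x -> (forall z, G (x, z) -> z = y) ->
    (C x <-> ~ C y).
Proof.
move=> /internal2P[a ia ea].
have [|sa [sb [c /star_powN[ic _ _] /= mc]]] := @transfer_ex powN vnat_lt
  (BAll 6 (BAll 7 (BImp
    (BAnd (BAnd (BRel 4 1 0) (BRel 9 0 1)) (BAll 8 (BImp (BRel 5 2 0) (BEq 0 1))))
    (BIff (BMem 1 2) (BNot (BMem 0 2)))))) a a _ ia ia.
  move=> a' b' sa sb; pose at_ n : V := atom (nat_base U n).
  have at_in n : vmem (at_ n) N by apply/vmem_vnat; exists n.
  have at_at n : is_atom (at_ n) by exists (nat_base U n).
  (* Here [a'] is arbitrary, so it is first cut down to the points where it is single-valued and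
     regressive. *)
  have [|m n n' [_ _ h] [h' _ _]|C HC] := @regressive_coloring (fun m n =>
    [/\ rel2 a' (at_ m) (at_ n), (n < m)%N
      & forall k, rel2 a' (at_ m) (at_ k) -> k = n]).
  - by move=> m n [].
  - exact: h.
  have [c cP mc] := powN_comprehension (fun x => exists2 n, x = at_ n & C n).
  have {}mc n : vmem (at_ n) c <-> C n.
    rewrite mc //; split=> [[k [/nat_base_inj ->]] //|Cn]; by exists n.
  exists c => //= _ /vmem_vnat[m ->] _ /vmem_vnat[n ->] [[]].
  rewrite -!/(at_ _) !bsat_rel //= vnat_ltP => amn mn h; rewrite !mc; apply: HC.
  split=> // k amk; have := h (at_ k) (at_in k).
  by rewrite bsat_rel //= => /(_ amk)[/nat_base_inj].
exists [set x | vmem (sval x) c]; first by apply/internal1P; exists c.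
have at_ := @hypernat_atom.
move=> x y Gxy yx h; apply: (mc _ (svalP x) _ (svalP y)).
rewrite !bsat_rel //=; split; first by split=> //; apply/ea.
move=> _ /vmem_hypernat[z ->]; rewrite bsat_rel //= -ea => Gxz.
by rewrite (h _ Gxz).
Qed.

Lemma internal1_saturation (D : nat -> set (hypernat U)) :
  countably_saturated U -> (forall n, internal1 (D n)) ->
  (forall n, exists x, forall k, (k <= n)%N -> D k x) ->
  exists x, forall k, D k x.
Proof.
move=> sat /choice[a Da] fip.
have aD k x : vmem (sval x) (a k) <-> D k x.
  have [_ _ ->] := Da k; split=> [[y Dy /hypernat_inj <- //]|Dx].
  by exists x.
have [n|n|v va] := sat a.
- by have [? ?] := Da n.
- by have [x Dx] := fip n; exists (sval x) => k /Dx /aD.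
have : vmem v (a 0) by exact: va.
have [_ _ ->] := Da 0 => -[x _ ex].
by exists x => k; apply/aD; rewrite ex.
Qed.

End Transfer.

(** * Sets determined by countably many internal sets *)

Section Saturated.
Variables (T : Type) (Int : set T -> Prop).
Hypothesis Int_nand : forall A B, Int A -> Int B -> Int [set x | ~ (A x /\ B x)].
Variables (I : countType) (i0 : I) (B : I -> set T).
Hypothesis Int_B : forall i, Int (B i).

Lemma Int_setC (A : set T) : Int A -> Int (~` A).
Proof.
move=> iA; suff -> : ~` A = [set x | ~ (A x /\ A x)] by exact: Int_nand.
by apply/seteqP; split=> x /= nA; [case|move=> Ax; apply: nA].
Qed.

Lemma Int_setI (A C : set T) : Int A -> Int C -> Int (A `&` C).
Proof.
move=> iA iC; suff -> : A `&` C = ~` [set x | ~ (A x /\ C x)].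
  exact/Int_setC/Int_nand.
by apply/seteqP; split=> x /= h; [apply|apply: contrapT].
Qed.

Lemma Int_setT : Int setT.
Proof.
suff -> : [set: T] = ~` (B i0 `&` ~` B i0).
  by apply/Int_setC/Int_setI => //; exact: Int_setC.
by rewrite setICr setC0.
Qed.

(** Numbers that code no index get [setT], which separates no points. *)
Let Bn n : set T := if unpickle n is Some i then B i else setT.

Let cell (s : seq bool) : set T :=
  [set x | forall i, (i < size s)%N -> (Bn i x <-> nth false s i)].

Lemma Int_cell s : Int (cell s).
Proof.
elim/last_ind: s => [|s b IH].
  suff -> : cell [::] = setT by exact: Int_setT.
  by apply/seteqP; split=> x // _ i.
have Int_Bn n : Int (Bn n).
  by rewrite /Bn; case: unpickle => //; exact: Int_setT.
have -> : cell (rcons s b) =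
    cell s `&` (if b then Bn (size s) else ~` Bn (size s)).
  apply/seteqP; split=> [x cx|x [cx bx] i].
    split=> [i il|].
      by have := cx i; rewrite size_rcons nth_rcons il ltnS => -> //; exact: ltnW.
    have := cx (size s); rewrite size_rcons nth_rcons ltnn eqxx => /(_ (leqnn _)) e.
    by case: b e {cx} => e; [apply/e|move=> /e].
  rewrite size_rcons ltnS leq_eqVlt nth_rcons => /orP[/eqP ->|il].
    by rewrite ltnn eqxx; case: b bx.
  by rewrite il; exact: cx.
by apply: Int_setI => //; case: b => //; exact: Int_setC.
Qed.

(** [F] consists of the membership sequences realized by points of [P]. The cells along such a
    sequence intersect in the points that have this sequence, and the hypothesis places them in
    [P]. *)
Lemma saturated_countably_determined (P : set T) :
  (forall x y, P x -> (forall i, B i x <-> B i y) -> P y) ->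
  countably_determined Int P.
Proof.
move=> satP.
exists [set f | exists2 x, P x & forall n, Bn n x <-> f n], cell; split.
- exact: Int_cell.
- move=> s t /prefixP[u ->] x cx i il; have := cx i.
  by rewrite size_cat nth_cat il; apply; rewrite ltn_addr.
apply/seteqP; split=> [x Px|y [f [x Px xf] yf]].
  exists (fun n => `[< Bn n x >]); first by exists x => // n; split=> /asboolP.
  move=> m _ i; rewrite size_mkseq => im; rewrite nth_mkseq //.
  by split=> /asboolP.
(* Length [(pickle i).+1] is the least at which a cell records membership in [B i]. *)
apply: satP Px _ => i; have := yf (pickle i).+1 Logic.I (pickle i).
rewrite size_mkseq nth_mkseq // ltnSn => /(_ isT).
by rewrite -xf /Bn pickleK => ->.
Qed.

End Saturated.

(** * Enumerations and iterated uniformization *)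

Lemma countable_enumeration (T : Type) (A : set T) : countable A -> A !=set0 ->
  exists f : nat -> T, forall x, A x -> exists n, x = f n.
Proof.
move=> /countable_injP[g inj_g] [x0 Ax0].
have /choice[f Hf] : forall n, exists x, forall y, A y -> g y = n -> y = x.
  move=> n; have [[x [Ax gx]]|h] := pselect (exists x, A x /\ g x = n).
    by exists x => y Ay gy; apply: inj_g; rewrite ?inE // gx gy.
  by exists x0 => y Ay gy; case: h; exists y.
by exists f => x Ax; exists (g x); exact: Hf.
Qed.

Definition uniformizes (T : Type) (R G : set (T * T)) :=
  [/\ G `<=` R, forall x y y', G (x, y) -> G (x, y') -> y' = y
    & forall x y, R (x, y) -> exists y', G (x, y')].

Section Residue.
Variables (T : Type) (R G : nat -> set (T * T)).
Hypothesis unifG : forall k, uniformizes (R k) (G k).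
Hypothesis R_S : forall k, R k.+1 = R k `\` G k.

(** Each round removes one point from a nonempty section at [x], so a section listed by [k] values
    is empty after [k] rounds. *)
Lemma residue_exhausted k j x (f : nat -> T) :
  (forall y, R j (x, y) -> exists2 i, (i < k)%N & y = f i) ->
  forall y, ~ R (j + k) (x, y).
Proof.
elim: k j f => [|k IH] j f Rf y; first by rewrite addn0 => /Rf[].
rewrite addnS -addSn.
have [[g Gg]|noG] := pselect (exists g, G j (x, g)); last first.
  apply: (IH _ f) => z; rewrite R_S => -[Rz _].
  by have [_ _ /(_ _ _ Rz)] := unifG j.
have [GR G_fun _] := unifG j.
have [i ik gi] := Rf _ (GR _ Gg).
(* The removed point is [f i]; moving the last value [f k] into slot [i] leaves a list of length
   [k]. *)
apply: (IH _ (fun l => if l == i then f k else f l)) => z; rewrite R_S => -[Rz nGz].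
have [l] := Rf _ Rz; rewrite ltnS leq_eqVlt => /orP[/eqP ->|lk] zl; last first.
  by exists l => //; case: eqP => // li; case: nGz; rewrite zl li -gi.
exists i; last by rewrite eqxx.
move: ik; rewrite ltnS leq_eqVlt => /orP[/eqP ik|//].
by case: nGz; rewrite zl -ik -gi.
Qed.

Lemma residue_cover k x y :
  ~ R k (x, y) -> R 0 (x, y) -> exists j, G j (x, y).
Proof.
move=> nR R0; apply: contrapT => nG; apply: nR.
by elim: k => // k IH; rewrite R_S; split=> // Gk; apply: nG; exists k.
Qed.

End Residue.

(** * Construction of the transversal *)

Section Transversal.
Variables (U : nonstandard_universe) (satU : countably_saturated U).
Notation H := (hypernat U).
Variables (E : H -> H -> Prop).
Hypothesis equivE : Equivalence E.
Variables (F : set (nat -> bool)) (S : seq bool -> set (H * H)).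
Hypotheses (int_S : forall s, internal2 (S s))
  (sub_S : forall s t, prefix s t -> S t `<=` S s)
  (E_S : [set xy | E xy.1 xy.2] =
         \bigcup_(f in F) \bigcap_(m in [set: nat]) S (mkseq f m)).
Hypothesis countE : forall x, countable (E x).

Lemma E_branch x y :
  E x y <-> exists2 f, F f & forall m, S (mkseq f m) (x, y).
Proof.
have -> : E x y = [set xy | E xy.1 xy.2] (x, y) by [].
by rewrite E_S; split=> -[f Ff h]; exists f => // m; exact: h.
Qed.

(** Let [g] enumerate the class of [x]. If for every [n] the section of [S (mkseq f n)] had a point
    other than [g 0], ..., [g n], saturation would give a point in all these sections, hence in the
    class, yet different from every [g n]. *)
Lemma section_finite x f : F f -> exists m k (g : nat -> H),
  forall y, S (mkseq f m) (x, y) -> exists2 i, (i < k)%N & y = g i.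
Proof.
move=> Ff; apply: contrapT => inf.
have [||g Eg] := @countable_enumeration _ (E x); first exact: countE.
  by exists x; reflexivity.
have [n|n|y Dy] := @internal1_saturation U
    (fun m => [set y | S (mkseq f m) (x, y)] `&` ~` [set g m]) satU.
- apply: Int_setI; first exact: internal1_nand.
    exact: internal1_section.
  apply: Int_setC; [exact: internal1_nand|exact: internal1_singleton].
- apply: contrapT => fin; apply: inf; exists n, n.+1, g => y Sy.
  apply: contrapT => ng; apply: fin; exists y => k kn; split=> /=.
    apply: sub_S Sy; apply/prefixP; exists (drop k (mkseq f n)).
    rewrite -[LHS](cat_take_drop k); congr (_ ++ _).
    by rewrite /mkseq -map_take take_iota; congr (map f (iota 0 _)); apply/minn_idPl.
  by move=> yg; apply: ng; exists k.
- have Exy : E x y by apply/E_branch; exists f => // m; have [] := Dy m.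
  by have [n ygn] := Eg _ Exy; have [_ /=] := Dy n.
Qed.

Lemma internal2_uniformizer : exists Uf : set (H * H) -> set (H * H),
  forall R, internal2 R -> internal2 (Uf R) /\ uniformizes R (Uf R).
Proof.
suff /choice[Uf HUf] : forall R : set (H * H), exists G,
    internal2 R -> internal2 G /\ uniformizes R G by exists Uf.
move=> R; have [iR|] := pselect (internal2 R); last by exists R.
by have [G []] := internal2_uniformization iR; exists G.
Qed.

(* Internal Lusin-Novikov: internal partial functions covering [E]. *)
Lemma internal_functions_cover : exists G : seq bool * nat -> set (H * H),
  [/\ forall i, internal2 (G i),
      forall i x y y', G i (x, y) -> G i (x, y') -> y' = y
    & forall x y, E x y -> exists i, G i (x, y)].
Proof.
have [Uf HUf] := internal2_uniformizer.
pose R s := fix R k := if k is k'.+1 then R k' `\` Uf (R k') else S s.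
have iR s k : internal2 (R s k).
  elim: k => //= k IH; apply: Int_setI; [exact: internal2_nand|exact: IH|].
  by apply: Int_setC; [exact: internal2_nand|have [] := HUf _ IH].
have unifR s k := HUf _ (iR s k).
exists (fun i => Uf (R i.1 i.2)); split.
- by move=> i; have [] := unifR i.1 i.2.
- by move=> i; have [_ []] := unifR i.1 i.2.
(* At level [m] the section at [x] has at most [k] points, so [k] rounds exhaust it and one of them
   removes [(x, y)]. *)
move=> x y /E_branch[f Ff Sf]; have [m [k [g Sg]]] := section_finite x Ff.
have uR j : uniformizes (R (mkseq f m) j) (Uf (R (mkseq f m) j)).
  by have [] := unifR (mkseq f m) j.
have ex := residue_exhausted uR (fun=> erefl) (j := 0) Sg.
have [||j Gj] := @residue_cover _ (R (mkseq f m)) _ (fun=> erefl) k x y.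
- exact: ex.
- exact: Sf.
- by exists (mkseq f m, j).
Qed.

Lemma CD_transversal_exists : exists A : set H, CD1 A /\ transversal_of E A.
Proof.
have [G [iG G_fun EG]] := internal_functions_cover.
have /choice[C HC] : forall i, exists C, internal1 C /\
    forall x y, G i (x, y) -> hyperlt y x -> (C x <-> ~ C y).
  move=> i; have [C iC HC] := internal_coloring (iG i).
  exists C; split=> // x y Gxy yx; apply: HC => // z; exact: G_fun.
pose tp x : set (seq bool * nat) := [set i | C i x].
(* Of two distinct equivalent points, the larger is sent to the smaller by some [G i], and then
   [C i] contains exactly one of them. *)
have tp_inj x y : E x y -> tp x = tp y -> x = y.
  suff wl x' y' : E x' y' -> tp x' = tp y' -> ~ hyperlt y' x'.
    move=> Exy txy; apply: contrapT => nxy.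
    have [|] := hyperlt_total nxy; first exact: (wl y x (symmetry Exy)).
    exact: wl.
  move=> Exy txy yx; have [i Gi] := EG _ _ Exy; have [_ /(_ _ _ Gi yx)] := HC i.
  have -> : C i x' <-> C i y' by rewrite -[C i x']/(tp x' i) txy.
  by tauto.
(* This set of types depends only on the class, so [ch] picks one type per class, and [tp_inj] turns
   that type into one point. *)
pose classtp x := [set tp y | y in E x].
have [ch Hch] : exists ch, forall x, classtp x (ch (classtp x)).
  have /choice[ch Hch] : forall S : set (set (seq bool * nat)), exists t,
      forall t', S t' -> S t.
    move=> S'; have [[t St]|n] := pselect (exists t, S' t); first by exists t.
    by exists set0 => t' St'; case: n; exists t'.
  exists ch => x; apply: (Hch _ (tp x)); exists x => //; reflexivity.
have classtpE x y : E x y -> classtp x = classtp y.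
  move=> Exy; apply/seteqP; split=> _ [z Ez <-]; exists z => //=.
    by transitivity x => //; symmetry.
  by transitivity y.
exists [set x | tp x = ch (classtp x)]; split; last first.
  move=> x; have [y Exy ty] := Hch x; exists y; split.
    by split=> //=; rewrite -(classtpE _ _ Exy).
  move=> z [/= tz Exz]; apply: tp_inj; first by transitivity x => //; symmetry.
  by rewrite ty tz -(classtpE _ _ Exz).
pose I : countType := ((seq bool * nat) + (seq bool * nat) * (seq bool * nat)
   + (seq bool * nat) * seq bool)%type.
(* Writing [G n] as a partial function, these sets record the type of [x], the type of each value of
   [G n] at [x], and which [S s] contain [x] paired with that value. *)
pose B (i : I) : set H := match i with
  | inl (inl n) => C n
  | inl (inr (n, m)) => [set x | exists y, (G n `&` [set xy | C m xy.2]) (x, y)]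
  | inr (n, s) => [set x | exists y, (G n `&` S s) (x, y)]
  end.
apply: (@saturated_countably_determined _ _ _ I (inl (inl ([::], 0))) B).
- exact: internal1_nand.
- move=> [[n|[n m]]|[n s]]; first by have [] := HC n.
    apply/internal1_dom/(Int_setI (@internal2_nand U) (iG n)).
    by apply: internal2_snd; have [] := HC m.
  exact/internal1_dom/(Int_setI (@internal2_nand U) (iG n))/int_S.
move=> x x' Ax xx'.
have tpE : tp x = tp x' by apply/seteqP; split=> i /(xx' (inl (inl i))).
(* If [y] is the value of [G n] at [z], then the value [y'] at [z'] has the same type and follows
   the same branch [f], so it lies in the class of [z']. The index [mkseq f 0] serves only to show
   that [G n] is defined at [z']. *)
have sub z z' : (forall i, B i z <-> B i z') -> classtp z `<=` classtp z'.
  move=> zz' _ [y Ezy <-]; have [n Gn] := EG _ _ Ezy.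
  have /E_branch[f Ff Sf] := Ezy.
  have /(zz' (inr (n, mkseq f 0)))[y' [Gn' _]] : B (inr (n, mkseq f 0)) z.
    by exists y; split.
  exists y'.
    apply/E_branch; exists f => // m.
    have /(zz' (inr (n, mkseq f m)))[y'' [Gn'' Sm]] : B (inr (n, mkseq f m)) z.
      by exists y; split.
    by rewrite (G_fun _ _ _ _ Gn'' Gn').
  apply/seteqP; split=> m Cm.
    have /(zz' (inl (inr (n, m))))[y'' [Gn'' /= Cm'']] : B (inl (inr (n, m))) z'.
      by exists y'; split.
    by rewrite /tp /= (G_fun _ _ _ _ Gn'' Gn).
  have /(zz' (inl (inr (n, m))))[y'' [Gn'' /= Cm'']] : B (inl (inr (n, m))) z.
    by exists y; split.
  by rewrite /tp /= (G_fun _ _ _ _ Gn'' Gn').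
rewrite /mkset -tpE Ax; congr ch.
by apply/seteqP; split; apply: sub => // i; rewrite xx'.
Qed.

End Transversal.

(** * From a transversal to smoothness *)

Lemma countably_determined_saturated (T : Type) (Int : set T -> Prop) (A : set T) :
  countably_determined Int A -> exists2 S : seq bool -> set T,
    forall s, Int (S s)
    & forall x y, A x -> (forall s, S s x <-> S s y) -> A y.
Proof.
move=> [F [S [iS _ ->]]]; exists S => // x y [f Ff Sf] xy.
by exists f => // m _; apply/xy/Sf.
Qed.

(** [theta] sends each point to the representative of its class in [A]. Its graph is the
    intersection of [E] with the cylinder over [A], so the internal sets that determine [E] and [A]
    together determine it. *)
Lemma CD_transversal_smooth (U : nonstandard_universe)
    (E : hypernat U -> hypernat U -> Prop) (A : set (hypernat U)) :
  Equivalence E -> CD_relation E -> CD1 A -> transversal_of E A -> CD_smooth E.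
Proof.
move=> equivE /countably_determined_saturated[S iS satS].
move=> /countably_determined_saturated[S' iS' satS'] trA.
have /choice[theta Ht] x : exists y, [/\ A y, E x y & forall z, A z -> E x z -> z = y].
  by have [y [[Ay Exy] uy]] := trA x; exists y; split=> // z Az Ez; rewrite (uy z).
have thetaE x y : y = theta x <-> A y /\ E x y.
  by have [At Et ut] := Ht x; split=> [->//|[Ay Ey]]; exact: ut.
exists theta => [|x x']; last first.
  have [_ Et _] := Ht x; have [At' Et' _] := Ht x'; split=> [Exx'|e].
    by apply/esym/thetaE; split=> //; transitivity x'.
  by transitivity (theta x) => //; rewrite e; symmetry.
pose B (i : seq bool + seq bool) : set (hypernat U * hypernat U) :=
  match i with inl s => S s | inr s => [set xy | S' s xy.2] end.
apply: (@saturated_countably_determined _ _ (@internal2_nand U) _ (inl [::]) B).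
  by move=> [s|s]; [exact: iS|apply: internal2_snd; exact: iS'].
move=> [x y] [x' y'] /thetaE[Ay Exy] xy; apply/thetaE; split.
  by apply: satS' Ay _ => s; exact: (xy (inr s)).
by apply: (satS (x, y) (x', y')) => // s; exact: (xy (inl s)).
Qed.

Theorem theorem6p1 (U : nonstandard_universe) (satU : countably_saturated U)
    (E : hypernat U -> hypernat U -> Prop)
    (equivE : Equivalence E)
    (cdE : CD_relation E)
    (countE : forall x : hypernat U, countable (fun y : hypernat U => E x y)) :
  (exists A : hypernat U -> Prop, CD1 A /\ transversal_of E A) /\
  CD_smooth E.
Proof.
have [F [S [int_S sub_S E_S]]] := cdE.
have [A [cdA trA]] := CD_transversal_exists satU equivE int_S sub_S E_S countE.
by split; [exists A|exact: CD_transversal_smooth cdA trA].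
Qed.
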